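(* Let $\Lambda$ be a numerical semigroup with conductor $c$ and multiplicity $m$. Then $\Lambda$ admits the substraction pattern of degree $\left\lceil\frac{c}{m}\right\rceil+1$.
   Context: $\mathbb{N}$ denotes the set of nonnegative integers. A numerical semigroup is a subset of $\mathbb{N}$ that contains $0$, is closed under addition and has finite complement in $\mathbb{N}$. The multiplicity of $\Lambda$ is its smallest positive element. The conductor of $\Lambda$ is the unique integer $c\in\Lambda$ such that $c-1\notin\Lambda$ and $c+\mathbb{N}\subseteq\Lambda$. The substraction pattern of degree $k$ is the polynomial $x_1+x_2+\dots+x_k-x_{k+1}$. A numerical semigroup $\Lambda$ admits a polynomial $p(x_1,\dots,x_n)$ of this kind (a pattern) if $p(s_1,\dots,s_n)\in\Lambda$ for all $s_1\geq s_2\geq\dots\geq s_n$ in $\Lambda$. *)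

(* Defs.v *)
From HB Require Import structures.
From mathcomp Require Import all_boot all_order all_algebra.
From mathcomp Require Import archimedean.
From mathcomp Require Import classical_sets cardinality.
From mathcomp Require Import mpoly.

Set Implicit Arguments.
Unset Strict Implicit.
Unset Printing Implicit Defensive.

Import Order.TTheory GRing.Theory Num.Theory.
Local Open Scope ring_scope.
Local Open Scope classical_set_scope.

Definition numerical_semigroup (L : set nat) : Prop :=
  [/\ L 0%N, (forall a b : nat, L a -> L b -> L (a + b)%N)
    & finite_set (~` L)].

(* A set of natural numbers seen as a set of integers, so that membership of a
   possibly negative integer makes sense without truncated subtraction. *)
Definition int_set (L : set nat) : set int := Posz @` L.

Definition multiplicity (L : set nat) (m : nat) : Prop :=
  [/\ L m, (0 < m)%N & forall n : nat, L n -> (0 < n)%N -> (m <= n)%N].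

(* The difference c - 1 is taken in int: for L = setT the conductor is 0, and
   -1 does not belong to L. *)
Definition conductor (L : set nat) (c : nat) : Prop :=
  [/\ L c, ~ int_set L (c%:Z - 1) & forall n : nat, L (c + n)%N].

(* The variables x_1, ..., x_k are those of index 0, ..., k - 1, and x_{k+1} is
   the one of index k = ord_max. *)
Definition subtraction_pattern (k : nat) : {mpoly int[k.+1]} :=
  \sum_(i < k) 'X_(widen_ord (leqnSn k) i) - 'X_ord_max.

Definition admits (L : set nat) (n : nat) (p : {mpoly int[n]}) : Prop :=
  forall s : 'I_n -> nat,
    (forall i, L (s i)) ->
    (forall i j : 'I_n, (i <= j)%N -> (s j <= s i)%N) ->
    int_set L p.@[fun i => (s i)%:Z].

(* The absolute value only casts the (nonnegative) integer ceiling to nat. *)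
Definition ceil_quotient (c m : nat) : nat :=
  `|Num.ceil (c%:R / m%:R : rat)|%N.

(* Main.v *)
(* If the last value s_(k+1) is 0, the pattern is a sum of elements of L.
   Otherwise every s_i is at least m and s_k - s_(k+1) >= 0, so with k = q + 1,
   q = ceil(c / m), the value is at least q m >= c. *)
Require Import Defs.
From mathcomp Require Import all_boot all_order all_algebra.
From mathcomp Require Import archimedean.
From mathcomp Require Import classical_sets.
From mathcomp Require Import mpoly.

Import Order.TTheory GRing.Theory Num.Theory.

Lemma leq_ceil_quotient (c m : nat) :
  (0 < m)%N -> (c <= ceil_quotient c m * m)%N.
Proof.
move=> m_gt0; rewrite /ceil_quotient; set x : rat := (c%:R / m%:R)%R.
have x_ge0 : (0 <= x)%R by rewrite divr_ge0 ?ler0n.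
(* Nonnegativity lets the absolute value in [ceil_quotient] be removed. *)
have ceilx_ge0 : (0 <= Num.ceil x)%R.
  by rewrite -(ler_int rat) (le_trans x_ge0) ?ceil_ge.
rewrite -(ler_nat rat) natrM -ler_pdivrMr ?ltr0n //.
by rewrite natr_absz ger0_norm ?ceil_ge.
Qed.

(** The hypothesis keeps the subtraction in [nat] from truncating, so the integer value comes with
    the natural witness that [int_set] asks for. *)
Lemma meval_subtraction_pattern (k : nat) (s : 'I_k.+1 -> nat) :
  (s ord_max <= \sum_(i < k) s (widen_ord (leqnSn k) i))%N ->
  (subtraction_pattern k).@[fun i => Posz (s i)]%R =
  Posz (\sum_(i < k) s (widen_ord (leqnSn k) i) - s ord_max)%N.
Proof.
move=> le_s; rewrite -subzn // mevalB raddf_sum mevalXU.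
by under eq_bigr do rewrite /= mevalXU; rewrite (big_morph Posz PoszD (erefl _)).
Qed.

Theorem proposition34 (L : set nat) (c m : nat)
    (hL : numerical_semigroup L)
    (hc : conductor L c)
    (hm : multiplicity L m) :
  admits L (subtraction_pattern (ceil_quotient c m + 1)).
Proof.
have [L0 LD _] := hL; have [_ _ Lc] := hc; have [_ m_gt0 m_min] := hm.
have := leq_ceil_quotient c m m_gt0; rewrite addn1.
move: (ceil_quotient c m) => q le_c_qm s Ls s_dec.
set S := (\sum_(i < q.+1) s (widen_ord (leqnSn q.+1) i))%N.
have LS : L S by rewrite /S; elim/big_ind: _.
(* The last summand is set apart to absorb [s ord_max]; the [q] others supply the bound [q * m]. *)
have S_split : S = (\sum_(i < q) s (widen_ord (leqnSn q.+1)
    (widen_ord (leqnSn q) i)) + s (widen_ord (leqnSn q.+1) ord_max))%N.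
  exact: big_ord_recr.
have le_last : (s ord_max <= s (widen_ord (leqnSn q.+1) ord_max))%N.
  by apply: s_dec; apply: leq_ord.
have le_lastS : (s ord_max <= S)%N.
  by rewrite S_split (leq_trans le_last) ?leq_addl.
exists (S - s ord_max)%N; last by rewrite meval_subtraction_pattern.
(* When [s ord_max] is zero other entries may vanish too, so [c] may not be reached, but the value
   is [S], already in [L]. *)
have [-> | last_gt0] := posnP (s ord_max); first by rewrite subn0.
suff le_c : (c <= S - s ord_max)%N by rewrite -(subnKC le_c).
rewrite S_split -addnBA // (leq_trans le_c_qm) // (leq_trans _ (leq_addr _ _)) //.
(* [q * m] becomes a constant sum over ['I_q], compared termwise: each entry is at least
   [s ord_max], hence positive, hence at least [m]. *)
rewrite -[X in (X * m)%N]card_ord -sum_nat_const leq_sum // => i _.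
apply: m_min => //; apply: leq_trans last_gt0 _.
by apply: s_dec; apply: leq_ord.
Qed.
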